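(* Let $n\ge 1$, let $H$ be a subgroup of $\mathbb{R}^n$ and let $m>1$ be an integer. Let $K_n$ be the set of linear functionals $\tau$ on $\mathbb{R}^n$ that are positive (i.e. $\tau(x)\ge 0$ for all $x$ with nonnegative coordinates) and satisfy $\tau(1,\dots,1)=1$; equivalently $K_n$ is the simplex with vertices the coordinate projections $\tau_1,\dots,\tau_n$. Let $Z(H)=\{\tau\in K_n \mid \tau(H)=\{0\}\}$, and let $F$ be the smallest face of $K_n$ containing $Z(H)$. Then the following are equivalent: (1) for every $\epsilon>0$ and every $h\in H$ there exists $h'\in H$ such that all coordinates of $h-mh'$ are $\ge -\epsilon$; (2) for every $\tau\in F$, either $\tau(H)=\{0\}$ or $\tau(H)$ is dense in $\mathbb{R}$.
   Context: A face of a convex set $K$ is a (possibly empty) subset $F\subseteq K$ such that any line segment in $K$ whose relative interior meets $F$ is contained in $F$. For any subset of $K$ there is a smallest face containing it. *)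

(* Defs.v *)
From mathcomp Require Import all_boot all_order all_algebra.
From mathcomp Require Import all_classical all_reals all_analysis.

Set Implicit Arguments.
Unset Strict Implicit.
Unset Printing Implicit Defensive.

Import Order.TTheory GRing.Theory Num.Theory.
Import numFieldNormedType.Exports.

Local Open Scope classical_set_scope.
Local Open Scope ring_scope.

Definition segment (R : realType) (V : lmodType R) (x y : V) : set V :=
  [set (1 - t) *: x + t *: y | t in [set t : R | 0 <= t <= 1]].

(* If x = y this is {x}, the relative interior of the degenerate segment. *)
Definition segment_relint (R : realType) (V : lmodType R) (x y : V) : set V :=
  [set (1 - t) *: x + t *: y | t in [set t : R | 0 < t < 1]].

(* F may be empty, and convexity of F is not part of the definition. *)
Definition is_face (R : realType) (V : lmodType R) (K F : set V) : Prop :=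
  F `<=` K /\
  forall x y : V, segment x y `<=` K ->
    segment_relint x y `&` F !=set0 -> segment x y `<=` F.

Definition smallest_face (R : realType) (V : lmodType R) (K A : set V) : set V :=
  smallest (is_face K) A.

Lemma is_faceT (R : realType) (V : lmodType R) (K : set V) : is_face K K.
Proof. by split. Qed.

Lemma smallest_face_is_face (R : realType) (V : lmodType R) (K A : set V) :
  A `<=` K -> is_face K (smallest_face K A).
Proof.
move=> AK; split; first by apply: smallest_sub => //; exact: is_faceT.
move=> x y xyK [z [xyz Fz]] w xyw G /= [Gface AG].
apply: (Gface.2 x y) => //; exists z; split => //.
exact: Fz.
Qed.

Notation functional R n := ('Hom('rV[R]_n, R^o)).

Definition positive_functional (R : realType) (n : nat) (tau : functional R n) :=
  forall x : 'rV[R]_n, (forall i, 0 <= x ord0 i) -> 0 <= (tau x : R).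

Definition state_space (R : realType) (n : nat) : set (functional R n) :=
  [set tau | positive_functional tau /\ tau (const_mx 1) = 1].
Arguments state_space R n : clear implicits.

Definition vanishing_states (R : realType) (n : nat) (H : set 'rV[R]_n) :
    set (functional R n) :=
  [set tau | state_space R n tau /\ tau @` H = [set 0]].

(* Main.v *)
(* Let S be the set of vertices i with tau_i > 0 for some tau in Z(H).  By
   convexity some tau0 in Z(H) has tau0_i > 0 for all i in S, and F consists of
   the states supported in S.

   (1) => (2): tau0 (h - m h') = 0 and h - m h' >= - eps force h - m h' to be
   small on S, so tau(H) lies in the closure of m tau(H) for tau in F; a
   subgroup of R with this property is 0 or dense.

   (2) => (1): if the projection of H to R^S were not dense in its span, some
   linear functional psi would map it onto a nontrivial discrete group
   (Kronecker), and the normalisation of tau0 + d psi, for small d > 0, would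
   contradict (2).  Hence h' can be found with h - m h' small on S.  Off S, the
   lemma of Tucker gives x >= 0 in the span of H with x_i > 0 for every i not in
   S, and, by simultaneous approximation, H contains elements g close to large
   multiples of x; then h - m (h' - g) is as required. *)
From HB Require Import structures.
Require Import Defs.
From mathcomp Require Import all_boot all_order all_algebra.
From mathcomp Require Import all_classical all_reals all_analysis.
From mathcomp Require Import ring lra.

Set Implicit Arguments.
Unset Strict Implicit.
Unset Printing Implicit Defensive.

Import Order.TTheory GRing.Theory Num.Theory.
Import numFieldNormedType.Exports.

Local Open Scope classical_set_scope.
Local Open Scope ring_scope.

(** * Simultaneous Diophantine approximation *)

(** Pigeonhole: the [Q ^ k + 1] multiples of [r] have fractional parts in [Q ^ k] boxes of side
    [1 / Q], so two of them share a box; [N] is the difference of their indices. *)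
Lemma dirichlet_approximation (R : archiRealFieldType) (k : nat) (r : 'I_k -> R)
    (Q : nat) (Q_gt0 : (0 < Q)%N) :
  exists2 N : nat, (0 < N <= Q ^ k)%N &
    exists z : 'I_k -> int, forall j, `|N%:R * r j - (z j)%:~R| <= Q%:R^-1.
Proof.
case: Q Q_gt0 => // q _; set Q := q.+1.
have Qp : 0 < Q%:R :> R by rewrite ltr0n.
pose frac (x : R) := x - (Num.floor x)%:~R.
have frac_itv x : 0 <= frac x < 1.
  by have := floor_itv x; rewrite /frac intrD; lra.
have bin_lt x : (Num.truncn (Q%:R * frac x) < Q)%N.
  have /andP[f0 f1] := frac_itv x.
  rewrite truncn_lt_nat ?mulr_ge0 ?ler0n //.
  by rewrite -[ltRHS]mulr1 ltr_pM2l.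
pose bin (a : 'I_(Q ^ k).+1) : {ffun 'I_k -> 'I_Q} :=
  [ffun j => Ordinal (bin_lt (a%:R * r j))].
have /injectivePn[a [b neq_ab eq_bin]] : ~~ injectiveb bin.
  apply/negP => /injectiveP/leq_card.
  by rewrite card_ffun !card_ord ltnn.
wlog lt_ab : a b neq_ab eq_bin / (a < b)%N.
  move=> wl; case: (ltngtP a b) => [||/val_inj/eqP]; first exact: wl.
    by apply: wl; rewrite // eq_sym.
  by rewrite (negPf neq_ab).
exists (b - a)%N.
  by rewrite subn_gt0 lt_ab (leq_trans (leq_subr _ _)) // -ltnS.
exists (fun j => Num.floor (b%:R * r j) - Num.floor (a%:R * r j)) => j.
have := congr1 (fun f : {ffun 'I_k -> 'I_Q} => val (f j)) eq_bin.
rewrite !ffunE /= natrB ?(ltnW lt_ab) // intrD mulrNz.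
set x := a%:R * r j; set y := b%:R * r j => eq_xy.
have -> : (b%:R - a%:R) * r j -
    ((Num.floor y)%:~R - (Num.floor x)%:~R) = frac y - frac x.
  by rewrite /frac /x /y; ring.
have /andP[x0 _] := frac_itv x; have /andP[y0 _] := frac_itv y.
have := truncn_itv (mulr_ge0 (ltW Qp) x0).
have := truncn_itv (mulr_ge0 (ltW Qp) y0).
rewrite eq_xy; set t := (Num.truncn _)%:R; rewrite -addn1 natrD -/t => ty tx.
rewrite -(ler_pM2l Qp) divff ?gt_eqF // -{1}(ger0_norm (ltW Qp)) -normrM.
by rewrite ler_norml; lra.
Qed.

(** * Subgroups of R^n: integral combinations, density and discreteness *)

Lemma zmod_closed_set (V : zmodType) (A : set V) :
  zmod_closed (mem A) ->
  A 0 /\ (forall x y, A x -> A y -> A (x - y)).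
Proof.
case=> A0 AB; split; first by move: A0; rewrite inE.
move=> x y Ax Ay; suff : x - y \in mem A by rewrite inE.
by apply: AB; rewrite inE.
Qed.

Lemma zmod_closed_mulrz (V : zmodType) (A : set V) (x : V) (z : int) :
  zmod_closed (mem A) -> A x -> A (x *~ z).
Proof.
move=> /zmod_closed_set[A0 AB] Ax.
have AN y : A y -> A (- y) by rewrite -sub0r; exact: AB.
have AMn n : A (x *+ n).
  elim: n => [|n IHn]; rewrite ?mulr0n // mulrS -[x *+ n]opprK.
  by apply: AB => //; exact: AN.
by case: z => n; [exact: AMn|rewrite NegzE mulrNz; exact/AN/AMn].
Qed.

Lemma zmod_closed_sumz (V : zmodType) (A : set V) (I : finType)
    (s : I -> V) (z : I -> int) :
  zmod_closed (mem A) -> (forall i, A (s i)) -> A (\sum_i s i *~ z i).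
Proof.
move=> Az As; have [A0 AB] := zmod_closed_set Az.
apply: big_ind => // [x y Ax Ay|i _]; last exact: zmod_closed_mulrz.
rewrite -[y]opprK -[- y]sub0r; by apply: (AB) => //; exact: AB.
Qed.

(** Vectors of [A] outside the current span are adjoined one at a time; the codimension bounds their
    number. *)
Lemma free_completion (K : fieldType) (V : vectType K) (A : set V) (s0 : seq V) :
  free s0 -> exists s : seq V, [/\ forall x, x \in s -> A x, free (s ++ s0)
    & forall x, A x -> x \in (span (s ++ s0))].
Proof.
have [k] := ubnP (\dim {:V} - size s0).
elim: k s0 => // k IHk s0 lek free_s0.
have [As0|] := pselect (forall x, A x -> x \in span s0).
  by exists [::]; split.
move=> /existsNP[a /not_implyP[Aa /negP a_notin]].
have free_as0 : free (a :: s0) by rewrite free_cons a_notin.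
have dim_as0 : (size s0 < \dim {:V})%N.
  have := dimvS (subvf (span (a :: s0))).
  by move: free_as0; rewrite /free => /eqP ->.
have [|s [sA free_s As]] := IHk (a :: s0) _ free_as0.
  by rewrite /= subnS; move: lek; rewrite ltnS; apply: leq_trans;
     rewrite ltn_predL subn_gt0.
exists (rcons s a); rewrite cat_rcons; split=> // x.
by rewrite mem_rcons inE => /predU1P[->|/sA].
Qed.

(** Rounding a coordinate along [s] down to an integer moves each entry of [w] by at most [d]. *)
Lemma lattice_approximation (R : archiRealFieldType) (n : nat)
    (A : set 'rV[R]_n) (s : seq 'rV[R]_n) (d : R) (w : 'rV[R]_n) :
  zmod_closed (mem A) -> (forall x, x \in s -> A x) ->
  (forall x, x \in s -> forall i, `|x ord0 i| <= d) -> w \in span s ->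
  exists h, [/\ A h, h \in span s
    & forall i, `|(w - h) ord0 i| <= (size s)%:R * d].
Proof.
move=> Az sA sd ws.
have sP (j : 'I_(size s)) : s`_j \in s by exact: mem_nth.
exists (\sum_(j < size s) s`_j *~ Num.floor (coord (in_tuple s) j w)); split.
- by apply: zmod_closed_sumz => // j; exact/sA/sP.
- by apply: memv_suml => j _; rewrite -scaler_int memvZ // memv_span.
move=> i; rewrite {1}(coord_span (X := in_tuple s) ws) -sumrB summxE.
apply: le_trans (ler_norm_sum _ _ _) _.
rewrite -[X in X%:R * _]card_ord mulr_natl -sumr_const ler_sum // => j _.
rewrite -scaler_int -scalerBl mxE normrM -[leRHS]mul1r.
rewrite ler_pM ?normr_ge0 ?sd //.
have := floor_itv (coord (in_tuple s) j w); rewrite intrD ler_norml.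
by lra.
Qed.

(** The bound [Q] depends on [s] and [eps] but not on [r]; this uniformity later yields a common
    denominator. *)
Lemma dirichlet_combination (R : archiRealFieldType) (n k : nat)
    (s : 'I_k -> 'rV[R]_n) (eps : R) (eps_gt0 : 0 < eps) :
  exists2 Q : nat, (0 < Q)%N & forall r : 'I_k -> R,
    exists2 N : nat, (0 < N <= Q)%N & exists z : 'I_k -> int,
      forall i, `|(N%:R *: (\sum_j r j *: s j) - \sum_j s j *~ z j) ord0 i|
                <= eps.
Proof.
pose B := \sum_j \sum_i `|s j ord0 i| : R.
have B_ge0 : 0 <= B by do 2!apply: sumr_ge0 => ? _.
have sB j i : `|s j ord0 i| <= B.
  rewrite /B (bigD1 j) //= (bigD1 i) //= -addrA lerDl addr_ge0 //.
    exact: sumr_ge0.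
  by do 2!apply: sumr_ge0 => ? _.
(* Errors of [1 / q] in the [k] coefficients cost at most [k * B / q <= eps] in each entry. *)
pose q := (Num.bound (k%:R * B / eps)).+1.
have q_gt0 : 0 < q%:R :> R by rewrite ltr0n.
exists (q ^ k)%N; first by rewrite expn_gt0.
move=> r; have [//|N Nq [z zP]] := @dirichlet_approximation R k r q.
exists N => //; exists z => i.
rewrite scaler_sumr -sumrB summxE.
apply: le_trans (ler_norm_sum _ _ _) _.
apply: (@le_trans _ _ (\sum_(j < k) q%:R^-1 * B)).
  apply: ler_sum => j _.
  rewrite scalerA -scaler_int -scalerBl mxE normrM.
  by rewrite ler_pM ?normr_ge0 ?sB.
rewrite sumr_const card_ord -[leLHS]mulr_natl mulrCA ler_pdivrMl //.
rewrite -ler_pdivrMr //.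
have /archi_boundP/ltW : 0 <= k%:R * B / eps.
  by rewrite divr_ge0 ?mulr_ge0 ?ler0n // ltW.
by move=> /le_trans; apply; rewrite ler_nat.
Qed.

(* The subspace W that decides between the two cases is the span of the vectors
   of A in [-e, e]^n for small e: A `&` W is dense in W, and A is uniformly
   discrete modulo W.  By Dirichlet, bounded multiples of the coordinates of A
   along a complement of W are then close to integers, hence equal to them. *)
Lemma divisible_or_discrete_functional (R : archiRealFieldType) (n : nat)
    (A : set 'rV[R]_n) :
  zmod_closed (mem A) ->
  (forall h (m : nat) (eps : R), A h -> (0 < m)%N -> 0 < eps ->
     exists2 h', A h' & forall i, `|(h - h' *+ m) ord0 i| <= eps)
  \/
  (exists (y : 'rV[R]_n) (M : nat), [/\ (0 < M)%N,
     forall h, A h -> exists z : int,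
       M%:R * (\sum_i y ord0 i * h ord0 i) = z%:~R
   & exists2 h, A h & \sum_i y ord0 i * h ord0 i != 0]).
Proof.
move=> Az; have [A0 AB] := zmod_closed_set Az.
pose small (e : R) (x : 'rV[R]_n) := forall i, `|x ord0 i| <= e.
pose base (e : R) (s : seq 'rV[R]_n) :=
  [/\ forall x, x \in s -> A x /\ small e x, free s
    & forall x, A x /\ small e x -> x \in span s].
have base_ex e : exists s, base e s.
  have [s [sA]] :=
    @free_completion _ _ [set x | A x /\ small e x] [::] (nil_free _).
  by rewrite cats0 => fs As; exists s.
pose P d := `[< exists s e, [/\ 0 < e, base e s & size s = d] >].
have exP : exists d, P d.
  have [s bs] := base_ex 1; exists (size s).
  by apply/asboolP; exists s, 1; split; rewrite ?ltr01.
(* As [d] is minimal, shrinking [e] further no longer shrinks the span [W] of [s]. *)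
have [d /asboolP[s [e [e_gt0 [sAe free_s Ae_s] size_s]]] min_d] := ex_minnP exP.
have sA x : x \in s -> A x by case/sAe.
have W_dense (eps : R) w : 0 < eps -> w \in span s ->
    exists h, [/\ A h, h \in span s & small eps (w - h)].
  move=> eps_gt0 ws.
  have d1_gt0 : 0 < d.+1%:R :> R by rewrite ltr0n.
  (* Rounding along [d] vectors with entries at most [eps / (d + 1)] costs at most [eps]; the [+ 1]
     covers [d = 0]. *)
  pose e' := Num.min e (eps / d.+1%:R).
  have e'_gt0 : 0 < e' by rewrite lt_min e_gt0 divr_gt0.
  have [s' [s'A free_s' As']] := base_ex e'.
  have le_d : (d <= size s')%N.
    by apply: min_d; apply/asboolP; exists s', e'.
  have sub_s's : (span s' <= span s)%VS.
    apply/span_subvP => x /s'A[Ax xe']; apply: Ae_s; split=> // i.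
    by apply: le_trans (xe' i) _; rewrite ge_min lexx.
  have eq_s's : span s' = span s.
    apply/eqP; rewrite eqEdim sub_s's (eqP free_s') (eqP free_s).
    by rewrite size_s.
  have size_s' : size s' = d.
    by rewrite -size_s -(eqP free_s) -(eqP free_s') eq_s's.
  have [|||h [Ah hs' hw]] := @lattice_approximation _ _ A s' e' w Az.
  - by move=> x /s'A[].
  - by move=> x /s'A[].
  - by rewrite eq_s's.
  exists h; split; rewrite // -?eq_s's // => i.
  apply: le_trans (hw i) _; rewrite size_s'.
  have le_e' : e' <= eps / d.+1%:R by rewrite ge_min lexx orbT.
  apply: le_trans (ler_wpM2l (ler0n _ _) le_e') _.
  rewrite mulrCA ger_pMr // ler_pdivrMr // mul1r ler_nat.
  exact: leqnSn.
(* Such an [h] is within [e] of an element of [A] in [W], and [Ae_s] puts the difference in [W]. *)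
have discrete h w : A h -> w \in span s -> small (e / 2) (h - w) ->
    h \in span s.
  move=> Ah ws hw; have [|h' [Ah' h's wh']] := @W_dense (e / 2) w _ ws.
    by rewrite divr_gt0.
  rewrite -[h](subrK h'); apply: memvD => //; apply: Ae_s.
  split; first exact: AB.
  move=> i; have := ler_normD ((h - w) ord0 i) ((w - h') ord0 i).
  have := hw i; have := wh' i.
  have -> : (h - h') ord0 i = (h - w) ord0 i + (w - h') ord0 i.
    by rewrite !mxE; ring.
  by lra.
have [t [tA free_ts Ats]] := @free_completion _ _ A s free_s.
(* If [t] is empty, [A] lies in [W], where [h / m] can be approximated. Otherwise the coordinate
   along the head [a] of [t] is the functional sought. *)
case: t tA free_ts Ats => [_ _ AW|a t tA free_ts Ats]; [left|right].
  move=> h m eps Ah m_gt0 eps_gt0.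
  have m_gt0' : 0 < m%:R :> R by rewrite ltr0n.
  have [||h' [Ah' _ hh']] := @W_dense (eps / m%:R) (m%:R^-1 *: h).
  - by rewrite divr_gt0.
  - by rewrite memvZ // AW.
  exists h' => // i; have := hh' i.
  rewrite ler_pdivlMr // mulrC -[X in X * _](ger0_norm (ltW m_gt0')) -normrM.
  rewrite !mxE mulrBr mulrA divff ?gt_eqF // mul1r.
  suff -> : (h' *+ m) ord0 i = m%:R * h' ord0 i by [].
  by rewrite -scaler_nat mxE.
pose X := in_tuple (a :: t ++ s).
pose phi : {scalar 'rV[R]_n} := coord X ord0.
have phi_a : phi a = 1 := coord_free (X := X) ord0 ord0 free_ts.
have phi_ts x : x \in t ++ s -> phi x = 0.
  move=> /(nthP 0)[j j_lt <-].
  exact: (coord_free (X := X) (lift ord0 (Ordinal j_lt)) ord0 free_ts).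
have phi_s x : x \in span s -> phi x = 0.
  move=> /(coord_span (X := in_tuple s)) ->; rewrite linear_sum big1 // => j _.
  by rewrite linearZ /= phi_ts ?mulr0 // mem_cat mem_nth ?orbT.
have phiE (h : 'rV[R]_n) :
    \sum_i (\row_i phi (delta_mx 0 i)) ord0 i * h ord0 i = phi h.
  rewrite [in RHS](row_sum_delta h) linear_sum; apply: eq_bigr => i _.
  by rewrite linearZ /= mxE mulrC.
pose f (j : 'I_(size t).+1) := (a :: t)`_j.
have fA j : A (f j) by apply/tA/mem_nth.
have [|Q Q_gt0 QP] := @dirichlet_combination R n _ f (e / 2).
  by rewrite divr_gt0.
(* Each [h] has its own multiplier [N <= Q]; the factorial is a multiple of all of them. *)
exists (\row_i phi (delta_mx 0 i)), Q`!; split; first exact: fact_gt0.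
  move=> h Ah; rewrite phiE.
  have := Ats h Ah; rewrite span_cat => /memv_addP[v vt [w ws hvw]].
  have [N /andP[N_gt0 NQ] [z zP]] := QP (fun j => coord (in_tuple (a :: t)) j v).
  move: zP; rewrite -(coord_span (X := in_tuple (a :: t)) vt).
  set g := \sum_j _ => zP.
  have gA : A g by exact: zmod_closed_sumz.
  (* Since [g] is within [e / 2] of [N * v], the difference is within [e / 2] of [N * w]. As [phi]
     vanishes on [W], [N * phi h] will equal the integer [phi g]. *)
  have in_W : h *+ N - g \in span s.
    apply: (discrete _ (w *+ N)).
    - by apply: AB => //; exact: (zmod_closed_mulrz N).
    - by rewrite -scaler_nat memvZ.
    - move=> i; rewrite hvw mulrnDl -addrA [- g - _]addrC addrA addrK.
      by rewrite -scaler_nat; exact: zP.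
  have phi_g : phi g = (z ord0)%:~R.
    rewrite linear_sum big_ord_recl big1 ?addr0 => [|j _].
      by rewrite -scaler_int linearZ /= phi_a mulr1.
    rewrite -scaler_int linearZ /= phi_ts ?mulr0 //.
    by rewrite mem_cat; apply/orP; left; exact: (mem_nth 0 (ltn_ord j)).
  have Nphi : N%:R * phi h = (z ord0)%:~R.
    apply/eqP; rewrite -phi_g -subr_eq0 mulr_natl.
    by rewrite -raddfMn -raddfB /= (phi_s _ in_W).
  have /dvdnP[c ->] : (N %| Q`!)%N by rewrite dvdn_fact ?N_gt0.
  by exists (c%:Z * z ord0); rewrite natrM -mulrA Nphi intrM.
exists a; first by apply: tA; rewrite mem_head.
by rewrite phiE phi_a oner_neq0.
Qed.

(** * Theorems of the alternative: the lemma of Tucker *)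

(** Either column [i] of [A] is a combination of the columns in [C], which gives [y], or a
    functional vanishing on those columns separates it from them, which gives [x]. *)
Lemma kernel_alternative (F : fieldType) (m n : nat) (A : 'M[F]_(m, n))
    (i : 'I_n) (C : seq 'I_n) :
  i \notin C ->
  (exists x : 'rV[F]_n, [/\ (x <= A)%MS, x ord0 i = 1
     & forall j, j \in C -> x ord0 j = 0])
  \/
  (exists y : 'rV[F]_n, [/\ y *m A^T = 0, y ord0 i = 1
     & forall j, j != i -> j \notin C -> y ord0 j = 0]).
Proof.
move=> iC; pose D : 'M[F]_n := diag_mx (\row_j (j \in C)%:R).
have [/submxP[c eq_c]|i_notin] := boolP (row i A^T <= D *m A^T)%MS; [right|left].
  exists (delta_mx 0 i - c *m D); split.
  - by rewrite mulmxBl -mulmxA -eq_c -rowE subrr.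
  - by rewrite mul_mx_diag !mxE !eqxx (negPf iC) mulr0 subr0.
  - move=> j ji jC.
    by rewrite mul_mx_diag !mxE (negPf ji) (negPf jC) andbF mulr0 subr0.
move: i_notin; rewrite submxE => /rV0Pn[k]; set K := cokermx _; pose X := A^T *m K.
have -> : (row i A^T *m K) 0 k = X i k by rewrite -row_mul mxE.
have XA : ((col k X)^T <= A)%MS.
  by rewrite /X colE -mulmxA trmx_mul trmxK submxMl.
have DX : D *m X = 0 by rewrite mulmxA mulmx_coker.
clearbody X => Xik; exists ((X i k)^-1 *: (col k X)^T); split.
- exact: scalemx_sub.
- by rewrite !mxE mulVf.
- move=> j jC; move/matrixP/(_ j k): DX.
  by rewrite mul_diag_mx !mxE jC mul1r => ->; rewrite mulr0.
Qed.

(* Deletion and contraction of the head of P: if neither settles the matter,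
   the two solutions x, y satisfy 0 = x . y >= x_i * y_i + x_j * y_j. *)
Lemma tucker_alternative (R : realFieldType) (m n : nat) (A : 'M[R]_(m, n))
    (i : 'I_n) (P C : seq 'I_n) :
  uniq (i :: P ++ C) ->
  (exists x : 'rV[R]_n, [/\ (x <= A)%MS, 0 < x ord0 i,
     forall j, j \in P -> 0 <= x ord0 j & forall j, j \in C -> x ord0 j = 0])
  \/
  (exists y : 'rV[R]_n, [/\ y *m A^T = 0, 0 < y ord0 i,
     forall j, j \in P -> 0 <= y ord0 j
   & forall j, j != i -> j \notin P ++ C -> y ord0 j = 0]).
Proof.
elim: P C => [|j P IHP] C.
  case/andP=> iC _.
  have [[x [xA xi xC]]|[y [yA yi yC]]] := @kernel_alternative _ _ _ A i C iC.
    by left; exists x; split; rewrite ?xi.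
  by right; exists y; split; rewrite ?yi.
rewrite cat_cons => uniq_ijPC.
have uniq_iPjC : uniq (i :: P ++ j :: C).
  rewrite -(perm_uniq (s1 := i :: j :: P ++ C)) //.
  by rewrite perm_cons -cat1s -[j :: C]cat1s perm_catCA.
have uniq_iPC : uniq (i :: P ++ C).
  by move: uniq_ijPC => /= /and3P[]; rewrite inE negb_or => /andP[_ ->] _ ->.
(* With [j] moved to [C], [x] vanishes at [j] and [y] is free there; with [j] in neither list, [x]
   is free at [j] and [z] vanishes there. *)
have [[x [xA xi xP xC]]|[y [yA yi yP yC]]] := IHP _ uniq_iPjC.
  left; exists x; split=> // k; last by move=> kC; rewrite xC // inE kC orbT.
  by rewrite inE => /predU1P[->|/xP//]; rewrite xC // mem_head.
have [[x [xA xi xP xC]]|[z [zA zi zP zC]]] := IHP _ uniq_iPC; last first.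
  right; exists z; split=> // k.
    rewrite inE => /predU1P[->|/zP//]; rewrite zC //.
      by move: uniq_ijPC => /= /andP[]; rewrite inE negb_or eq_sym => /andP[].
    by move: uniq_ijPC => /= /and3P[].
  by move=> ki; rewrite inE negb_or => /andP[_]; exact: zC.
have [xj|xj] := lerP 0 (x ord0 j).
  by left; exists x; split=> // k; rewrite inE => /predU1P[->|/xP].
have [yj|yj] := lerP 0 (y ord0 j).
  right; exists y; split=> // k; first by rewrite inE => /predU1P[->|/yP].
  move=> ki kPC; apply: yC => //; move: kPC.
  by rewrite !(inE, mem_cat) orbCA.
have xy0 : \sum_k x ord0 k * y ord0 k = 0.
  have /submxP[u xu] := xA.
  transitivity ((y *m x^T) ord0 ord0).
    by rewrite mxE; apply: eq_bigr => k _; rewrite mxE mulrC.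
  by rewrite xu trmx_mul mulmxA yA mul0mx mxE.
have xy_ge0 k : 0 <= x ord0 k * y ord0 k.
  have [->|ki] := eqVneq k i; first exact/ltW/mulr_gt0.
  have [->|kj] := eqVneq k j; first by rewrite ltW ?nmulr_rgt0.
  have [kP|kP] := boolP (k \in P); first by rewrite mulr_ge0 ?xP ?yP.
  have [kC|kC] := boolP (k \in C); first by rewrite xC // mul0r.
  by rewrite yC ?mulr0 // mem_cat inE !negb_or kP kj.
move: xy0; rewrite (bigD1 i) //= => /eqP.
by rewrite gt_eqF // ltr_wpDr ?sumr_ge0 ?mulr_gt0.
Qed.

(** The lemma of Tucker with every index other than [i] in [P], which makes the support condition on
    [y] vacuous. *)
Lemma nonnegative_span_alternative (R : realFieldType) (n : nat)
    (s : seq 'rV[R]_n) (i : 'I_n) :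
  (exists x, [/\ x \in span s, 0 < x ord0 i & forall j, 0 <= x ord0 j])
  \/
  (exists y : 'rV[R]_n, [/\ forall x, x \in s -> \sum_j y ord0 j * x ord0 j = 0,
     0 < y ord0 i & forall j, 0 <= y ord0 j]).
Proof.
pose A := \matrix_(k < size s) s`_k.
have uniq_i : uniq (i :: rem i (enum 'I_n) ++ [::]).
  by rewrite cats0 /= mem_rem_uniqF ?rem_uniq ?enum_uniq.
have rem_i j : j != i -> j \in rem i (enum 'I_n).
  by move=> ji; rewrite (rem_filter _ (enum_uniq _)) mem_filter /= ji mem_enum.
have nonneg (x : 'rV[R]_n) : 0 < x ord0 i ->
    (forall j, j \in rem i (enum 'I_n) -> 0 <= x ord0 j) ->
    forall j, 0 <= x ord0 j.
  move=> xi xP j; have [->|/rem_i/xP//] := eqVneq j i; exact: ltW.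
have [[x [/submxP[u xu] xi xP _]]|[y [yA yi yP _]]] :=
  @tucker_alternative _ _ _ A i _ [::] uniq_i; [left|right].
  exists x; split=> //; last exact: nonneg.
  rewrite xu mulmx_sum_row memv_suml // => k _.
  by rewrite memvZ // rowK memv_span // mem_nth.
exists y; split=> //; last exact: nonneg.
move=> x /(nthP 0)[k ks <-].
have /rowP/(_ (Ordinal ks)) := yA; rewrite !mxE => yAk; rewrite -[RHS]yAk.
by apply: eq_bigr => j _; rewrite !mxE.
Qed.

(** * Approximation in subgroups of R^n and of R *)

(** Dirichlet places an element of [A] within [eps] of [N * M * x]; as [N >= 1] and [x >= 0], the
    uncontrolled factor [N] only enlarges the entries. *)
Lemma large_nonnegative_approximant (R : archiRealFieldType) (n : nat)
    (A : set 'rV[R]_n) (s : seq 'rV[R]_n) (x : 'rV[R]_n) (eps B : R) :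
  zmod_closed (mem A) -> (forall v, v \in s -> A v) -> x \in span s ->
  (forall i, 0 <= x ord0 i) -> 0 < eps ->
  exists2 g, A g & forall i,
    - eps <= g ord0 i /\ (0 < x ord0 i -> B <= g ord0 i).
Proof.
move=> Az sA xs x_ge0 eps_gt0.
(* Chosen so that [M * x] is at least [B + eps] wherever [x] is positive; the extra [eps] absorbs
   the approximation error. *)
pose M := Num.bound (\sum_i `|(B + eps) / x ord0 i|).
have MP i : 0 < x ord0 i -> B + eps <= M%:R * x ord0 i.
  move=> xi; rewrite -ler_pdivrMr //; apply: le_trans (ler_norm _) _.
  have : \sum_i `|(B + eps) / x ord0 i| <= M%:R.
    by apply/ltW/archi_boundP; exact: sumr_ge0.
  by apply: le_trans; rewrite (bigD1 i) //= lerDl sumr_ge0.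
have [Q _ QP] :=
  @dirichlet_combination R n (size s) (fun j => s`_j) eps eps_gt0.
have [N /andP[N_gt0 _] [z]] := QP (fun j => coord (in_tuple s) j (M%:R *: x)).
rewrite -(coord_span (X := in_tuple s)) ?memvZ // => zP.
exists (\sum_(j < size s) s`_j *~ z j).
  by apply: zmod_closed_sumz => // j; exact/sA/mem_nth.
move=> i; move: (zP i); set g := \sum_j _.
rewrite !mxE ler_norml => /andP[_ gi].
have N_ge1 : 1 <= N%:R :> R by rewrite ler1n.
have Mx_ge0 : 0 <= M%:R * x ord0 i by rewrite mulr_ge0 ?ler0n.
have NMx : M%:R * x ord0 i <= N%:R * (M%:R * x ord0 i) by rewrite ler_peMl.
split; first by lra.
by move=> /MP; lra.
Qed.

Lemma positive_lower_bound (R : realFieldType) (n : nat) (a : 'I_n -> R) :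
  exists2 e : R, 0 < e & forall i, 0 < a i -> e <= a i.
Proof.
(* The default value 1 keeps the minimum positive when no [a i] is. *)
exists (\big[Num.min/1]_(i | 0 < a i) a i).
  by apply: (big_ind (fun x => 0 < x)) => // x y x_gt0 y_gt0; rewrite lt_min x_gt0.
by move=> i ai; apply: bigmin_le_cond.
Qed.

Lemma discrete_not_dense (R : realType) (G : set R) (c : R) :
  0 < c -> (forall g, G g -> exists z : int, g = c * z%:~R) -> ~ dense G.
Proof.
move=> c_gt0 Gc /(_ `]0, c[%classic) [].
- by exists (c / 2); rewrite /= in_itv /=; lra.
- exact: interval_open.
- move=> g [/=]; rewrite in_itv /= => /andP[g0 gc] /Gc[z gz]; move: g0 gc.
  rewrite gz pmulr_rgt0 // gtr_pMr // ltr0z ltrz1.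
  by case: z {gz} => // -[].
Qed.

(** If [G] has arbitrarily small nonzero elements, their multiples are dense. Otherwise nonzero
    elements have size at least some [e], approximate division by [m] is exact, and writing [g] as
    [m ^ k] times an element of [G] with [m ^ k > |g| / e] forces [g = 0]. *)
Lemma trivial_or_dense (R : realType) (G : set R) (m : nat) :
  zmod_closed (mem G) -> (1 < m)%N ->
  (forall g (d : R), G g -> 0 < d ->
     exists2 g', G g' & `|g - g' *+ m| <= d) ->
  G = [set 0] \/ dense G.
Proof.
move=> Gz m_gt1 Gm; have [G0 GB] := zmod_closed_set Gz.
have [tiny|] :=
  pselect (forall e : R, 0 < e -> exists g, [/\ G g, g != 0 & `|g| < e]).
  right=> O [x Ox] Oo.
  have /nbhs_ballP[e /= e_gt0 xeO] := open_nbhs_nbhs (conj Oo Ox).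
  have [g [Gg g_neq0 g_lt]] := tiny e e_gt0.
  exists (g *~ Num.floor (x / g)); split; last exact: zmod_closed_mulrz.
  apply: xeO; rewrite /ball /=; apply: le_lt_trans g_lt.
  have -> : x - g *~ Num.floor (x / g) = g * (x / g - (Num.floor (x / g))%:~R).
    by rewrite mulrBr mulrCA divff // mulr1 mulrzr.
  rewrite normrM -[leRHS]mulr1 ler_wpM2l //.
  by have := floor_itv (x / g); rewrite intrD ler_norml; lra.
move=> /existsNP[e /not_implyP[e_gt0 no_tiny]]; left.
have gap g : G g -> g != 0 -> e <= `|g|.
  by move=> Gg g_neq0; rewrite leNgt; apply/negP => ge; apply: no_tiny; exists g.
have divG g : G g -> exists2 g', G g' & g = g' *+ m.
  move=> Gg; have [|g' Gg' gg'] := Gm g (e / 2) Gg; first by rewrite divr_gt0.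
  exists g' => //; apply/eqP; rewrite -subr_eq0; apply/negPn/negP => /gap.
  have Ggm : G (g - g' *+ m) by apply: GB => //; exact: (zmod_closed_mulrz m).
  by move=> /(_ Ggm); lra.
apply/seteqP; split=> [g Gg|_ ->//]; apply/eqP/negPn/negP => g_neq0.
have powG k : exists2 g', G g' & g = g' *+ m ^ k.
  elim: k => [|k [g' Gg' ->]]; first by exists g.
  by have [g'' Gg'' ->] := divG g' Gg'; exists g''; rewrite // -mulrnA expnS.
have [g' Gg' gg'] := powG (Num.bound (`|g| / e)).
have g'_neq0 : g' != 0 by apply: contraNneq g_neq0 => g'0; rewrite gg' g'0 mul0rn.
have := archi_boundP (divr_ge0 (normr_ge0 g) (ltW e_gt0)).
rewrite ltr_pdivrMr //; apply/negP; rewrite -leNgt {2}gg' normrMn -[leRHS]mulr_natl.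
by rewrite ler_pM ?ler0n ?gap ?(ltW e_gt0) // ler_nat ltnW // ltn_expl.
Qed.

(** * States, supports and faces of the simplex *)

Lemma functionalE (R : realType) (n : nat) (tau : functional R n)
    (x : 'rV[R]_n) :
  tau x = \sum_i tau (delta_mx 0 i) * x ord0 i :> R.
Proof.
rewrite [in LHS](row_sum_delta x) linear_sum; apply: eq_bigr => i _.
by rewrite linearZ /= mulrC.
Qed.

Lemma functional_of_row (R : realType) (n : nat) (y : 'rV[R]_n) :
  exists2 tau : functional R n,
    forall x, tau x = \sum_i y ord0 i * x ord0 i :> R &
    forall i, tau (delta_mx 0 i) = y ord0 i :> R.
Proof.
pose f (x : 'rV[R]_n) : R^o := \sum_i y ord0 i * x ord0 i.
have f_linear : linear f.
  move=> a u v; rewrite /f scaler_sumr -big_split; apply: eq_bigr => i _ /=.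
  by rewrite !mxE /GRing.scale /=; ring.
pose L := GRing.isLinear.Build R 'rV[R]_n R^o *:%R f f_linear.
pose fL : {linear 'rV[R]_n -> R^o} := HB.pack f L.
exists (linfun fL) => [x|i]; rewrite lfunE //=.
rewrite /f (bigD1 i) //= big1 ?addr0 => [|k ki].
  by rewrite mxE !eqxx mulr1.
by rewrite mxE (negPf ki) andbF mulr0.
Qed.

Lemma comb_functionalE (R : realType) (n : nat) (s t : functional R n)
    (a b : R) (x : 'rV[R]_n) :
  (a *: s + b *: t) x = a * s x + b * t x :> R.
Proof. by rewrite add_lfunE !scale_lfunE. Qed.

Lemma state_spaceP (R : realType) (n : nat) (tau : functional R n) :
  state_space R n tau <->
  (forall i, 0 <= tau (delta_mx 0 i) :> R) /\
  \sum_i tau (delta_mx 0 i) = 1 :> R.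
Proof.
have tau1 : tau (const_mx 1) = \sum_i tau (delta_mx 0 i) :> R.
  by rewrite functionalE; apply: eq_bigr => i _; rewrite mxE mulr1.
split=> -[tau_ge0 sum1]; split; [|by rewrite -tau1| |by rewrite tau1].
  by move=> i; apply: tau_ge0 => j; rewrite mxE ler0n.
by move=> x x_ge0; rewrite functionalE sumr_ge0 // => i _; rewrite mulr_ge0.
Qed.

Lemma state_space_conv (R : realType) (n : nat) (s t : functional R n) (a : R) :
  state_space R n s -> state_space R n t -> 0 <= a <= 1 ->
  state_space R n ((1 - a) *: s + a *: t).
Proof.
move=> /state_spaceP[s_ge0 s1] /state_spaceP[t_ge0 t1] /andP[a0 a1].
apply/state_spaceP; split=> [i|].
  by rewrite comb_functionalE addr_ge0 ?mulr_ge0 ?subr_ge0.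
under eq_bigr do rewrite comb_functionalE.
by rewrite big_split /= -!mulr_sumr s1 t1; ring.
Qed.

(** The states supported where [tau0] is form a face containing [Z]. Conversely, [tau0] is positive
    throughout that support, hence interior to a segment of states ending at any such [tau]. *)
Lemma smallest_face_state_space (R : realType) (n : nat)
    (Z : set (functional R n)) (tau0 : functional R n) :
  Z `<=` state_space R n -> Z tau0 ->
  (forall tau i, Z tau -> tau0 (delta_mx 0 i) = 0 -> tau (delta_mx 0 i) = 0) ->
  forall tau, smallest_face (state_space R n) Z tau <->
    state_space R n tau /\
    forall i, tau0 (delta_mx 0 i) = 0 -> tau (delta_mx 0 i) = 0.
Proof.
move=> ZK Z0 supp0 tau; split.
  pose G := [set t : functional R n | state_space R n t /\
    forall i, tau0 (delta_mx 0 i) = 0 -> t (delta_mx 0 i) = 0].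
  suff : smallest_face (state_space R n) Z `<=` G by apply.
  apply: smallest_sub; last by move=> t Zt; split=> [|i]; [exact: ZK|exact: supp0].
  split=> [t [] //|x y xyK [_ [[t /= /andP[t0 t1] <-] [_ zG]]] w xyw].
  split; first exact: xyK.
  have Kx : state_space R n x.
    by apply: xyK; exists 0; rewrite /= ?lexx ?ler01 // subr0 scale1r scale0r addr0.
  have Ky : state_space R n y.
    by apply: xyK; exists 1; rewrite /= ?lexx ?ler01 // subrr scale1r scale0r add0r.
  move=> i /zG; rewrite comb_functionalE => xy0.
  have /state_spaceP[/(_ i) xi _] := Kx; have /state_spaceP[/(_ i) yi _] := Ky.
  move/eqP: xy0; rewrite paddr_eq0 ?mulr_ge0 ?subr_ge0 ?(ltW t0) ?(ltW t1) //.
  rewrite !mulf_eq0 gt_eqF ?subr_gt0 //= (gt_eqF t0) /= => /andP[/eqP x0 /eqP y0].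
  by case: xyw => u _ <-; rewrite comb_functionalE x0 y0 !mulr0 addr0.
move=> [Ktau supp_tau] G [[_ G_face] ZG].
have [e e_gt0 eP] := @positive_lower_bound R n (fun i => tau0 (delta_mx 0 i)).
have /state_spaceP[tau0_ge0 tau0_sum] := ZK _ Z0.
have /state_spaceP[tau_ge0 tau_sum] := Ktau.
have e1_gt0 : 0 < 1 + e by rewrite addr_gt0.
(* tau0 is interior to the segment from tau' to tau. *)
pose tau' := (1 + e) *: tau0 + (- e) *: tau.
have Ktau' : state_space R n tau'.
  (* On the support of [tau0], [(1 + e) * tau0_i >= e >= e * tau_i]; off it both coordinates
     vanish. *)
  apply/state_spaceP; split=> [i|].
    rewrite comb_functionalE.
    have tau_le1 : tau (delta_mx 0 i) <= 1 :> R.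
      by rewrite -tau_sum (bigD1 i) //= lerDl sumr_ge0.
    have [/eP|le0] := ltrP 0 (tau0 (delta_mx 0 i) : R).
      by have := tau_ge0 i; nra.
    have tau0_i : tau0 (delta_mx 0 i) = 0.
      by apply/eqP; rewrite eq_le le0 tau0_ge0.
    by rewrite tau0_i supp_tau // !mulr0 addr0.
  under eq_bigr do rewrite comb_functionalE.
  by rewrite big_split /= -!mulr_sumr tau0_sum tau_sum; ring.
apply: (G_face tau' tau).
- by move=> _ [t /= t01 <-]; exact: state_space_conv.
- exists tau0; split; last exact: ZG.
  (* The solution [u] of [(1 - u) * tau' + u * tau = tau0]. *)
  exists (e / (1 + e)).
    by rewrite /= divr_gt0 //= ltr_pdivrMr // mul1r ltrDr.
  rewrite /tau' scalerDr !scalerA -addrA -scalerDl.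
  have -> : (1 - e / (1 + e)) * (1 + e) = 1 by field; exact: lt0r_neq0.
  have -> : (1 - e / (1 + e)) * - e + e / (1 + e) = 0 by field; exact: lt0r_neq0.
  by rewrite scale1r scale0r addr0.
- by exists 1; rewrite /= ?lexx ?ler01 // subrr scale1r scale0r add0r.
Qed.

Lemma vanishing_statesP (R : realType) (n : nat) (H : set 'rV[R]_n)
    (tau : functional R n) :
  H 0 -> vanishing_states H tau <->
         state_space R n tau /\ forall h, H h -> tau h = 0.
Proof.
move=> H0; split=> -[Ktau tauH]; split=> //.
  by move=> h Hh; have := imageP tau Hh; rewrite tauH.
apply/seteqP; split=> [_ [h Hh <-]|_ ->]; first exact: tauH.
by exists 0; rewrite // linear0.
Qed.

(** Average [n] vanishing states, the [i]-th being nonzero at [i] whenever some vanishing state is;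
    nonnegativity excludes cancellation. *)
Lemma maximal_support_state (R : realType) (n : nat) (H : set 'rV[R]_n) :
  (1 <= n)%N -> H 0 -> vanishing_states H !=set0 ->
  exists2 tau0 : functional R n, vanishing_states H tau0 &
    forall tau i, vanishing_states H tau ->
      tau0 (delta_mx 0 i) = 0 -> tau (delta_mx 0 i) = 0.
Proof.
move=> n_ge1 H0 [t0 Zt0].
have /choice[t tP] (i : 'I_n) : exists t, vanishing_states H t /\
    forall tau, vanishing_states H tau ->
      t (delta_mx 0 i) = 0 -> tau (delta_mx 0 i) = 0.
  have [[t [Zt ti]]|no] := pselect (exists t : functional R n,
      vanishing_states H t /\ t (delta_mx 0 i) != 0).
    by exists t; split=> // tau _ ti0; move: ti; rewrite ti0 eqxx.
  exists t0; split=> // tau Ztau _; apply/eqP/negPn/negP => tau_i.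
  by apply: no; exists tau.
have n_gt0 : 0 < n%:R^-1 :> R by rewrite invr_gt0 ltr0n.
pose tau0 : functional R n := n%:R^-1 *: \sum_i t i.
have tau0E x : tau0 x = n%:R^-1 * \sum_i t i x :> R.
  by rewrite scale_lfunE sum_lfunE.
have tK i : (forall j, 0 <= t i (delta_mx 0 j) :> R) /\
    \sum_j t i (delta_mx 0 j) = 1 :> R.
  by apply/state_spaceP; case: (tP i) => -[].
exists tau0.
  apply/vanishing_statesP => //; split.
    apply/state_spaceP; split=> [j|].
      rewrite tau0E mulr_ge0 ?(ltW n_gt0) // sumr_ge0 // => i _.
      by have [] := tK i.
    under eq_bigr do rewrite tau0E.
    rewrite -mulr_sumr exchange_big /=.
    under eq_bigr => i _ do rewrite (tK i).2.
    by rewrite sumr_const card_ord mulVf // pnatr_eq0 -lt0n.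
  move=> h Hh; rewrite tau0E big1 ?mulr0 // => i _.
  have [/(vanishing_statesP _ H0)[_ tiH] _] := tP i; exact: tiH.
move=> tau i Ztau; rewrite tau0E => /eqP.
rewrite mulf_eq0 gt_eqF //= psumr_eq0 => [|j _]; last by have [] := tK j.
move=> /allP/(_ i (mem_index_enum _))/eqP ti0.
by have [_] := tP i; apply.
Qed.

(** If no suitable [x] exists for one [i], the alternative gives a [y] whose normalisation is a
    vanishing state positive at [i]. The sum of the vectors found for the separate [i] serves all of
    them. *)
Lemma positive_off_support (R : realType) (n : nat) (H : set 'rV[R]_n)
    (s : seq 'rV[R]_n) :
  H 0 -> (forall h, H h -> h \in span s) ->
  exists x, [/\ x \in span s, forall i, 0 <= x ord0 i
    & forall i, (forall tau, vanishing_states H tau ->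
                   tau (delta_mx 0 i) = 0) -> 0 < x ord0 i].
Proof.
move=> H0 Hs.
have /choice[x xP] (i : 'I_n) : exists x, [/\ x \in span s,
    forall j, 0 <= x ord0 j
    & (forall tau, vanishing_states H tau -> tau (delta_mx 0 i) = 0) ->
      0 < x ord0 i].
  have [[x [xs xi x_ge0]]|[y [ys yi y_ge0]]] :=
    nonnegative_span_alternative s i; first by exists x.
  exists 0; split=> [|j|Zi]; rewrite ?mem0v ?mxE //; exfalso.
  have y_sum : 0 < \sum_j y ord0 j.
    by rewrite (bigD1 i) //= ltr_wpDr ?sumr_ge0.
  have [tau tauE tau_delta] := functional_of_row ((\sum_j y ord0 j)^-1 *: y).
  have {}tauE v : tau v = (\sum_j y ord0 j)^-1 * \sum_j y ord0 j * v ord0 j :> R.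
    by rewrite tauE mulr_sumr; apply: eq_bigr => j _; rewrite mxE mulrA.
  have {}tau_delta j :
      tau (delta_mx 0 j) = (\sum_j y ord0 j)^-1 * y ord0 j :> R.
    by rewrite tau_delta mxE.
  have : vanishing_states H tau.
    apply/vanishing_statesP => //; split.
      apply/state_spaceP; split=> [j|].
        by rewrite tau_delta mulr_ge0 // invr_ge0 ltW.
      under eq_bigr do rewrite tau_delta.
      by rewrite -mulr_sumr mulVf // gt_eqF.
    move=> h /Hs /(coord_span (X := in_tuple s)) ->.
    rewrite linear_sum big1 // => k _.
    by rewrite linearZ /= tauE ys ?mulr0 ?scaler0 // mem_nth.
  move/Zi => /eqP; rewrite [_ == _](_ : _ = (tau (delta_mx 0 i) == 0 :> R)) //.
  by rewrite tau_delta mulf_eq0 invr_eq0 !gt_eqF.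
exists (\sum_i x i); split.
- by apply: memv_suml => i _; have [] := xP i.
- by move=> j; rewrite summxE sumr_ge0 // => i _; have [] := xP i.
- move=> i Zi; rewrite summxE (bigD1 i) //= ltr_wpDr ?sumr_ge0 //.
    by move=> j _; have [] := xP j.
  by have [_ _ /(_ Zi)] := xP i.
Qed.

(** * The two implications *)

Lemma divisible_trivial_or_dense (R : realType) (n : nat) (H : set 'rV[R]_n)
    (m : nat) (tau0 tau : functional R n) :
  zmod_closed (mem H) -> (1 < m)%N ->
  (forall eps : R, 0 < eps -> forall h : 'rV[R]_n, H h ->
     exists2 h' : 'rV[R]_n, H h' &
       forall i : 'I_n, - eps <= (h - h' *+ m) ord0 i) ->
  vanishing_states H tau0 -> state_space R n tau ->
  (forall i, tau0 (delta_mx 0 i) = 0 -> tau (delta_mx 0 i) = 0) ->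
  tau @` H = [set 0] \/ dense (tau @` H : set R).
Proof.
move=> Hz m_gt1 Hm; have [H0 HB] := zmod_closed_set Hz.
move=> /(vanishing_statesP _ H0)[/state_spaceP[a_ge0 a_sum] tau0H].
move=> /state_spaceP[b_ge0 b_sum] supp_tau.
have tau0E := functionalE tau0; have tauE := functionalE tau.
have [e e_gt0 eP] := @positive_lower_bound R n (fun i => tau0 (delta_mx 0 i)).
apply: (@trivial_or_dense R (tau @` H) m) => //.
  split; first by rewrite inE; exists 0; rewrite ?linear0.
  move=> x y; rewrite !inE => -[h Hh <-] [k Hk <-].
  by exists (h - k); [exact: HB|rewrite linearB].
move=> _ d [h Hh <-] d_gt0.
(* The tolerance carries a factor [e] because the bounds extracted from [tau0] are divided by
   weights that are at least [e]. *)
have [h' Hh' hh'] := Hm (d * e) (mulr_gt0 d_gt0 e_gt0) h Hh.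
exists (tau h'); first by exists h'.
rewrite -raddfMn -raddfB /=.
set x := h - h' *+ m in hh' *.
have Hx : H x by apply: HB => //; exact: (zmod_closed_mulrz m).
(* Since [tau0 x = 0], the nonnegative numbers [x_i + d * e] have weighted mean [d * e], which
   bounds each weighted term from above. *)
have sum0 : \sum_i tau0 (delta_mx 0 i) * (x ord0 i + d * e) = d * e :> R.
  under eq_bigr do rewrite mulrDr.
  by rewrite big_split -mulr_suml a_sum mul1r /= -tau0E tau0H // add0r.
have x_small i : 0 < tau0 (delta_mx 0 i) :> R -> `|x ord0 i| <= d.
  move=> ai; have eai := eP i ai.
  have ai_le1 : tau0 (delta_mx 0 i) <= 1 :> R.
    by rewrite -a_sum (bigD1 i) //= lerDl sumr_ge0.
  have xi := hh' i.
  have : tau0 (delta_mx 0 i) * (x ord0 i + d * e) <= d * e :> R.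
    rewrite -[leRHS]sum0 (bigD1 i) //= lerDl sumr_ge0 // => j _.
    by rewrite mulr_ge0 //; have := hh' j; lra.
  rewrite ler_norml => ub; apply/andP; split; first by nra.
  have : e * (x ord0 i + d * e) <= d * e.
    by apply: le_trans ub; rewrite ler_wpM2r //; lra.
  rewrite mulrC ler_pM2r // => ub'; have := mulr_gt0 d_gt0 e_gt0.
  by lra.
rewrite tauE -[leRHS]mul1r -b_sum mulr_suml.
apply: le_trans (ler_norm_sum _ _ _) _; apply: ler_sum => i _.
rewrite normrM ger0_norm //.
have [/x_small xi|le0] := ltrP 0 (tau0 (delta_mx 0 i) : R).
  by rewrite ler_wpM2l.
by rewrite supp_tau ?mul0r //; apply/eqP; rewrite eq_le le0 a_ge0.
Qed.

(** The part of (2) => (1) on coordinates charged by vanishing states: a discrete functional on the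
    projection of [H], added in a small multiple to a state of maximal support, would give a state
    in [F] with nonzero discrete image. *)
Lemma divisible_on_support (R : realType) (n : nat) (H : set 'rV[R]_n)
    (S : pred 'I_n) (m : nat) (eps : R) (h : 'rV[R]_n) :
  (1 <= n)%N -> zmod_closed (mem H) -> (0 < m)%N -> 0 < eps ->
  (forall i, S i -> exists2 tau, vanishing_states H tau &
     tau (delta_mx 0 i) != 0) ->
  (forall tau : functional R n,
     smallest_face (state_space R n) (vanishing_states H) tau ->
     tau @` H = [set 0] \/ dense (tau @` H : set R)) ->
  H h -> exists2 h', H h' & forall i, S i -> `|(h - h' *+ m) ord0 i| <= eps.
Proof.
move=> n_ge1 Hz m_gt0 eps_gt0 SP faceP Hh; have [H0 HB] := zmod_closed_set Hz.
pose P (x : 'rV[R]_n) := \row_i (if S i then x ord0 i else 0).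
have PB x y : P (x - y) = P x - P y.
  by apply/rowP => i; rewrite !mxE; case: ifP; rewrite ?subr0.
have PHz : zmod_closed (mem (P @` H)).
  split; first by rewrite inE; exists 0 => //; apply/rowP => i; rewrite !mxE if_same.
  move=> x y; rewrite !inE => -[u Hu <-] [v Hv <-].
  by exists (u - v); [exact: HB|exact: PB].
have [div|[y [M [M_gt0 discr [_ [h0 Hh0 <-] h0_neq0]]]]] :=
  divisible_or_discrete_functional PHz.
  have [_ [h' Hh' <-] hh'] := div (P h) m eps (imageP P Hh) m_gt0 eps_gt0.
  exists h' => // i Si; have := hh' i; congr (`|_| <= _).
  by rewrite -(scaler_nat m h') -(scaler_nat m (P h')) !mxE Si.
exfalso.
(* Truncated to [S], [y] takes on [x] the value it had on [P x], and perturbing [tau0] by it stays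
   within the support of [tau0]. *)
pose z : 'rV[R]_n := P y.
have zE (x : 'rV[R]_n) :
    \sum_i z ord0 i * x ord0 i = \sum_i y ord0 i * P x ord0 i.
  by apply: eq_bigr => i _; rewrite !mxE; case: ifP; rewrite ?mul0r ?mulr0.
(* Without vanishing states [S] would be empty and [z] zero. *)
have Zn0 : vanishing_states H !=set0.
  apply/set0P/eqP => Z0; move/eqP: h0_neq0; apply; rewrite -zE big1 // => i _.
  rewrite mxE; case: ifP => [/SP[tau]|_]; last by rewrite mul0r.
  by rewrite Z0.
have [tau0 Z0 supp0] := @maximal_support_state R n H n_ge1 H0 Zn0.
have /(vanishing_statesP _ H0)[K0 tau0H] := Z0.
have /state_spaceP[a_ge0 a_sum] := K0.
have [e e_gt0 eP] := @positive_lower_bound R n (fun i => tau0 (delta_mx 0 i)).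
have c_gt0 : 0 < 1 + \sum_i `|z ord0 i|.
  by rewrite ltr_pwDl // sumr_ge0.
(* This gives [d * |z_i| <= e / 2], so at least half of each coordinate of [tau0] survives; the
   [1 +] keeps the denominator positive. *)
pose d := e / 2 / (1 + \sum_i `|z ord0 i|).
have d_gt0 : 0 < d by rewrite !divr_gt0.
have az i : tau0 (delta_mx 0 i) / 2 <= tau0 (delta_mx 0 i) + d * z ord0 i :> R.
  have [Si|nSi] := boolP (S i); last first.
    by rewrite mxE (negPf nSi) mulr0 addr0; have := a_ge0 i; lra.
  have ai : e <= tau0 (delta_mx 0 i) :> R.
    apply: eP; rewrite lt_neqAle a_ge0 andbT eq_sym; apply/negP => /eqP a0.
    by have [tau Ztau /eqP] := SP i Si; apply; exact: supp0.
  have : d * `|z ord0 i| <= e / 2.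
    rewrite /d mulrAC ler_pdivrMr // ler_pM2l ?divr_gt0 //.
    apply: (@le_trans _ _ (\sum_i `|z ord0 i|)); last by rewrite lerDr.
    by rewrite (bigD1 i) //= lerDl sumr_ge0.
  rewrite -[d * `|_|](_ : `|d * z ord0 i| = _); last by rewrite normrM gtr0_norm.
  by rewrite ler_norml; lra.
pose q := \sum_i (tau0 (delta_mx 0 i) + d * z ord0 i : R).
have q_gt0 : 0 < q.
  apply: (@lt_le_trans _ _ (\sum_i (tau0 (delta_mx 0 i) / 2 : R))).
    by rewrite -mulr_suml a_sum divr_gt0.
  by apply: ler_sum => i _; exact: az.
have [psi psiE psi_delta] := functional_of_row z.
pose tau : functional R n := q^-1 *: tau0 + (q^-1 * d) *: psi.
have tau_delta i : tau (delta_mx 0 i) =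
    q^-1 * (tau0 (delta_mx 0 i) + d * z ord0 i) :> R.
  by rewrite comb_functionalE psi_delta; ring.
have tauH x : H x -> tau x = q^-1 * d * \sum_i y ord0 i * P x ord0 i :> R.
  by move=> Hx; rewrite comb_functionalE tau0H // mulr0 add0r psiE zE.
have [] := faceP tau.
- apply/(smallest_face_state_space _ Z0 supp0).
    by move=> t /(vanishing_statesP _ H0)[].
  split=> [|i a0].
    apply/state_spaceP; split=> [i|].
      rewrite tau_delta mulr_ge0 ?invr_ge0 ?(ltW q_gt0) //.
      by apply: le_trans (az i); rewrite divr_ge0.
    under eq_bigr do rewrite tau_delta.
    by rewrite -mulr_sumr mulVf // gt_eqF.
  have -> : tau (delta_mx 0 i) = tau (delta_mx 0 i) :> R by [].
  rewrite tau_delta a0 mxE; case: ifP => [/SP[t Zt /eqP[]]|_].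
    exact: supp0.
  by rewrite mulr0 addr0 mulr0.
- move=> tauH0; have := imageP tau Hh0; rewrite tauH0 => /eqP.
  rewrite [_ == _](_ : _ = (tau h0 == 0 :> R)) // tauH // mulf_eq0.
  by rewrite (negPf h0_neq0) gt_eqF // mulr_gt0 ?invr_gt0.
(* On [H], [tau0] vanishes and [psi] takes values in the multiples of [1 / M]. *)
- apply: (@discrete_not_dense R _ (q^-1 * d / M%:R)).
    by rewrite divr_gt0 ?mulr_gt0 ?invr_gt0 ?ltr0n.
  move=> _ [x Hx <-]; have [k Mk] := discr (P x) (imageP P Hx).
  exists k; rewrite tauH // -Mk [RHS]mulrA divfK //.
  by rewrite pnatr_eq0 -lt0n.
Qed.

Theorem theoremB (R : realType) (n : nat) (n_ge1 : (1 <= n)%N)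
    (H : set 'rV[R]_n) (H_subgroup : zmod_closed (mem H))
    (m : nat) (m_gt1 : (1 < m)%N) :
  (forall eps : R, 0 < eps -> forall h : 'rV[R]_n, H h ->
     exists2 h' : 'rV[R]_n, H h' &
       forall i : 'I_n, - eps <= (h - h' *+ m) ord0 i)
  <->
  (forall tau : 'Hom('rV[R]_n, R^o),
     smallest_face (state_space R n) (vanishing_states H) tau ->
     tau @` H = [set 0] \/ dense (tau @` H : set R)).
Proof.
have [H0 HB] := zmod_closed_set H_subgroup.
have ZK : vanishing_states H `<=` state_space R n.
  by move=> t /(vanishing_statesP _ H0)[].
split=> [div tau Ftau|faceP eps eps_gt0 h Hh].
  have [Zn0|Z0] := pselect (vanishing_states H !=set0).
    have [tau0 Z0 supp0] := @maximal_support_state R n H n_ge1 H0 Zn0.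
    have [+ _] := smallest_face_state_space ZK Z0 supp0 tau.
    move=> /(_ Ftau)[Ktau supp_tau].
    exact: (divisible_trivial_or_dense H_subgroup m_gt1 div Z0).
  (* When no state vanishes on [H], the empty set is already a face containing [Z(H)], so [F] is
     empty. *)
  exfalso; apply: (Ftau set0); split=> [|t Zt]; last by apply: Z0; exists t.
  by split=> // x y _ [? []].
have m_gt0 : (0 < m)%N := ltnW m_gt1.
have m_gt0' : 0 < m%:R :> R by rewrite ltr0n.
pose S : pred 'I_n := fun i => `[< exists2 tau, vanishing_states H tau &
   tau (delta_mx 0 i) != 0 >].
(* On [S], one half of [eps] is spent on [h'] and the other on the correction [m * g]. *)
have eps2_gt0 : 0 < eps / 2 by rewrite divr_gt0.
have [h' Hh' hh'] := @divisible_on_support R n H S m (eps / 2) h n_ge1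
  H_subgroup m_gt0 eps2_gt0 (fun i => @asboolW _) faceP Hh.
have [s [sH _]] := @free_completion _ _ H [::] (nil_free _).
rewrite cats0 => Hs.
have [x [xs x_ge0 xP]] := positive_off_support H0 Hs.
(* Off [S], an entry of [g] that is at least [B] outweighs any deficit of [h - m h']. *)
pose B := \sum_i `|(h - h' *+ m) ord0 i|.
have [|g Hg gP] := @large_nonnegative_approximant R n H s x
  (eps / 2 / m%:R) B H_subgroup sH xs x_ge0.
  by rewrite !divr_gt0.
exists (h' - g); first exact: HB.
move=> i; have [g_ge g_large] := gP i.
have -> : (h - (h' - g) *+ m) ord0 i = (h - h' *+ m) ord0 i + m%:R * g ord0 i.
  by rewrite -(scaler_nat m h') -(scaler_nat m (h' - g)) !mxE; ring.
have [/hh'|nSi] := boolP (S i).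
  move: g_ge; rewrite -(ler_pM2l m_gt0') mulrN mulrCA divff ?gt_eqF // mulr1.
  by rewrite ler_norml; lra.
have g_ge_B : B <= g ord0 i.
  apply/g_large/xP => tau Ztau; apply/eqP/negPn/negP => tau_i.
  by move/asboolPn: nSi; apply; exists tau.
have B_ge : `|(h - h' *+ m) ord0 i| <= B.
  by rewrite /B (bigD1 i) //= lerDl sumr_ge0.
have B_ge0 : 0 <= B := le_trans (normr_ge0 _) B_ge.
have : B <= m%:R * g ord0 i.
  apply: (le_trans g_ge_B); rewrite ler_peMl ?ler1n //.
  exact: le_trans B_ge0 g_ge_B.
by move: B_ge; rewrite ler_norml; lra.
Qed.
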